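(* Being nicely smooth is not a three space property; that is, there exist a real Banach space $X$ and a closed subspace $Y\subseteq X$ such that $Y$ and the quotient $X/Y$ are both nicely smooth but $X$ is not nicely smooth.
   Context: All Banach spaces are real. A set $A\subseteq B(X^* )$ (closed unit ball of $X^*$) is a norming set for $X$ if $\|x\|=\sup\{x^*(x):x^*\in A\}$ for all $x\in X$. A closed subspace $F\subseteq X^*$ is a norming subspace if its closed unit ball $B(F)$ is a norming set for $X$. $X$ is nicely smooth if $X^*$ contains no proper norming (closed) subspace. *)

(* Defs.v *)
From HB Require Import structures.
From mathcomp Require Import all_boot all_order all_algebra.
From mathcomp Require Import all_classical all_reals all_analysis.

Set Implicit Arguments.
Unset Strict Implicit.
Unset Printing Implicit Defensive.

Import Order.TTheory GRing.Theory Num.Theory.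
Import numFieldNormedType.Exports.

Local Open Scope classical_set_scope.
Local Open Scope ring_scope.

Definition unit_ball (R : realType) (X : normedModType R) : set X :=
  [set x | `|x| <= 1].
Arguments unit_ball {R} X.

(* Boolean predicates on X represent arbitrary subsets, by way of asbool. *)
Record closedSubspace (R : realType) (X : normedModType R) := ClosedSubspace {
  closed_pred :> {pred X};
  closed_pred_submod : submod_closed closed_pred;
  closed_predP : closed [set` closed_pred]
}.

HB.instance Definition _ (R : realType) (X : normedModType R)
    (Y : closedSubspace X) :=
  GRing.isSubmodClosed.Build R X (closed_pred Y) (closed_pred_submod Y).

Section Subspace.
Context (R : realType) (X : normedModType R) (Y : closedSubspace X).

Definition subspace_type : Type := {x : X | x \in Y}.

HB.instance Definition _ := SubChoice.on subspace_type.
HB.instance Definition _ := [SubChoice_isSubLmodule of subspace_type by <:].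

Definition subspace_norm (y : subspace_type) : R := `|val y|.

Let subspace_normD x y :
  subspace_norm (x + y) <= subspace_norm x + subspace_norm y.
Proof. by rewrite /subspace_norm raddfD ler_normD. Qed.

Let subspace_normZ a y : subspace_norm (a *: y) = `|a| * subspace_norm y.
Proof. by rewrite /subspace_norm linearZ /= normrZ. Qed.

Let subspace_norm0_eq0 y : subspace_norm y = 0 -> y = 0.
Proof.
move=> /normr0_eq0 y0.
by apply: val_inj; rewrite raddf0.
Qed.

HB.instance Definition _ := Lmodule_isNormed.Build R subspace_type
  subspace_normD subspace_normZ subspace_norm0_eq0.

End Subspace.

Section Quotient.
Local Open Scope quotient_scope.
Context (R : realType) (X : normedModType R) (Y : closedSubspace X).

(* The cosets x + Y, with the additive group structure of the library. *)
Definition quotient_type : Type := @Quotient.quot X (closed_pred Y).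

HB.instance Definition _ := GRing.Zmodule.on quotient_type.

Definition quotient_proj (x : X) : quotient_type :=
  \pi_(@Quotient.quot X (closed_pred Y)) x.

Lemma quotient_projD : {morph quotient_proj : x y / x + y}.
Proof. by move=> x y; rewrite /quotient_proj raddfD. Qed.

Lemma quotient_proj0 : quotient_proj 0 = 0.
Proof. by rewrite /quotient_proj raddf0. Qed.

Lemma quotient_projP x y : quotient_proj x = quotient_proj y <-> x - y \in Y.
Proof.
by rewrite Quotient.idealrBE; split=> [/eqP//|/eqP].
Qed.

Lemma quotient_proj_repr (q : quotient_type) : quotient_proj (repr q) = q.
Proof. exact: reprK. Qed.

Definition quotient_scale (a : R) (q : quotient_type) : quotient_type :=
  quotient_proj (a *: repr q).

Lemma quotient_projZ a x :
  quotient_proj (a *: x) = quotient_scale a (quotient_proj x).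
Proof.
apply/quotient_projP; rewrite -scalerBr rpredZ//.
by apply/quotient_projP; rewrite quotient_proj_repr.
Qed.

Let quotient_scaleA a b q :
  quotient_scale a (quotient_scale b q) = quotient_scale (a * b) q.
Proof. by rewrite -[q]quotient_proj_repr -!quotient_projZ scalerA. Qed.

Let quotient_scale1 : left_id 1 quotient_scale.
Proof. by move=> q; rewrite -[q]quotient_proj_repr -!quotient_projZ scale1r. Qed.

Let quotient_scaleDr : right_distributive quotient_scale +%R.
Proof.
move=> a q r; rewrite -[q]quotient_proj_repr -[r]quotient_proj_repr.
by rewrite -quotient_projD -!quotient_projZ -quotient_projD scalerDr.
Qed.

Let quotient_scaleDl q :
  {morph quotient_scale^~ q : a b / a + b}.
Proof.
move=> a b; rewrite -[q]quotient_proj_repr -!quotient_projZ.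
by rewrite -quotient_projD scalerDl.
Qed.

HB.instance Definition _ := GRing.Zmodule_isLmodule.Build R quotient_type
  quotient_scaleA quotient_scale1 quotient_scaleDr quotient_scaleDl.

Lemma quotient_proj_linear : linear quotient_proj.
Proof. by move=> a x y; rewrite quotient_projD quotient_projZ. Qed.

Definition quotient_norm (q : quotient_type) : R :=
  inf [set `|x| | x in [set x | quotient_proj x = q]].

Lemma quotient_norm_has_inf (q : quotient_type) :
  has_inf [set `|x| | x in [set x | quotient_proj x = q]].
Proof.
split; first by exists `|repr q|, (repr q) => //=; exact: quotient_proj_repr.
by exists 0 => _ [x _ <-].
Qed.

Lemma quotient_norm_le x : quotient_norm (quotient_proj x) <= `|x|.
Proof.
by apply: ge_inf; [case: (quotient_norm_has_inf (quotient_proj x))|exists x].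
Qed.

Lemma quotient_norm_lt (q : quotient_type) (e : R) : 0 < e ->
  exists2 x, quotient_proj x = q & `|x| < quotient_norm q + e.
Proof.
move=> e0; have [_ [x xq <-] xe] := inf_adherent e0 (quotient_norm_has_inf q).
by exists x.
Qed.

Let quotient_normD p q :
  quotient_norm (p + q) <= quotient_norm p + quotient_norm q.
Proof.
apply/ler_addgt0Pr => e e0; have e20 : 0 < e / 2 by rewrite divr_gt0.
have [x <- xe] := quotient_norm_lt p e20.
have [y <- ye] := quotient_norm_lt q e20.
rewrite -quotient_projD (le_trans (quotient_norm_le _))//.
rewrite (le_trans (ler_normD _ _))// (le_trans (ltW (ltrD xe ye)))//.
by rewrite addrACA -splitr.
Qed.

Let quotient_normZ_le a q : quotient_norm (a *: q) <= `|a| * quotient_norm q.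
Proof.
apply/ler_addgt0Pr => e e0.
have a1 : 0 < `|a| + 1 by rewrite ltr_wpDl.
have [x <- xe] := quotient_norm_lt q (divr_gt0 e0 a1).
have -> : a *: quotient_proj x = quotient_proj (a *: x) by rewrite quotient_projZ.
rewrite (le_trans (quotient_norm_le _))// normrZ.
rewrite (le_trans (ler_wpM2l (normr_ge0 a) (ltW xe)))// mulrDr lerD2l.
by rewrite mulrCA ger_pMr// ler_pdivrMr// mul1r lerDl.
Qed.

Let quotient_normZ a q : quotient_norm (a *: q) = `|a| * quotient_norm q.
Proof.
apply/eqP; rewrite eq_le quotient_normZ_le/=.
have [->|a0] := eqVneq a 0.
  rewrite normr0 mul0r; apply: lb_le_inf.
    by case: (quotient_norm_has_inf (0 *: q)).
  by move=> _ [x _ <-].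
rewrite -ler_pdivlMl ?normr_gt0// -normfV.
by rewrite (le_trans _ (quotient_normZ_le _ _))// scalerA mulVf// scale1r.
Qed.

Let quotient_norm0_eq0 q : quotient_norm q = 0 -> q = 0.
Proof.
rewrite -[q]quotient_proj_repr -quotient_proj0; set x := repr q => q0.
apply/quotient_projP; rewrite subr0.
suff : closure [set` Y] x by move=> /(closed_predP (c := Y)).
move=> B /nbhs_ballP[e /= e0 eB].
have [y yx ye] := quotient_norm_lt (quotient_proj x) e0.
exists (x - y); split; first by apply/quotient_projP; rewrite yx.
by apply: eB; rewrite -ball_normE /= opprB addrC subrK (lt_le_trans ye)// q0 add0r.
Qed.

HB.instance Definition _ := Lmodule_isNormed.Build R quotient_type
  quotient_normD quotient_normZ quotient_norm0_eq0.

End Quotient.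

Section Dual.
Context (R : realType) (X : normedModType R).

Definition dual_pred : {pred (X -> R^o)} :=
  fun f => `[< linear f /\ continuous f >].

Let dual_submod_closed : submod_closed dual_pred.
Proof.
split=> [|a f g].
  apply/asboolP; split=> [b x y|x]; last exact: cst_continuous.
  by rewrite scaler0 addr0.
move=> /asboolP[lf cf] /asboolP[lg cg]; apply/asboolP; split=> [b x y|x].
  transitivity (a *: f (b *: x + y) + g (b *: x + y)); first by [].
  rewrite lf lg !scalerDr scalerA mulrC -scalerA -!addrA; congr (_ + _).
  by rewrite addrCA.
by apply: cvgD; [apply: cvgZr; exact: cf|exact: cg].
Qed.

HB.instance Definition _ := GRing.isSubmodClosed.Build R (X -> R^o) dual_pred
  dual_submod_closed.

(* Continuous linear functionals, with the pointwise vector space structure. *)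
Definition dual : Type := {f : X -> R^o | f \in dual_pred}.

HB.instance Definition _ := SubChoice.on dual.
HB.instance Definition _ := [SubChoice_isSubLmodule of dual by <:].

Definition dual_fun (f : dual) : X -> R^o := val f.
Coercion dual_fun : dual >-> Funclass.

Lemma dual_linear (f : dual) : linear f.
Proof. by case: (asboolP _ (valP f)). Qed.

Lemma dual_continuous (f : dual) : continuous f.
Proof. by case: (asboolP _ (valP f)). Qed.

HB.instance Definition _ (f : dual) :=
  GRing.isLinear.Build R X R^o *:%R (dual_fun f) (dual_linear f).

Definition dual_norm (f : dual) : R := sup [set `|f x| | x in unit_ball X].

Lemma dual_norm_has_sup (f : dual) : has_sup [set `|f x| | x in unit_ball X].
Proof.
split; first by exists `|f 0|, 0 => //; rewrite /unit_ball /= normr0.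
have /linear_boundedP[M [Mreal fM]] : bounded_near f (nbhs (0 : X)).
  by apply: continuous_linear_bounded; exact: dual_continuous.
exists (`|M| + 1) => _ [x x1 <-].
have M1 : M < `|M| + 1 by rewrite (le_lt_trans (ler_norm M))// ltrDl.
by rewrite (le_trans (fM _ M1 x))// ler_piMr// addr_ge0.
Qed.

Lemma dual_norm_ge0 (f : dual) : 0 <= dual_norm f.
Proof.
apply: le_trans (normr_ge0 (f 0)) _.
apply: ub_le_sup; first by case: (dual_norm_has_sup f).
by exists 0 => //; rewrite /unit_ball /= normr0.
Qed.

Lemma dual_norm_le (f : dual) x : `|f x| <= dual_norm f * `|x|.
Proof.
have [->|x0] := eqVneq x 0; first by rewrite linear0 !normr0 mulr0.
have nx0 : 0 < `|x| by rewrite normr_gt0.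
rewrite -ler_pdivrMr// mulrC -[X in X * _]ger0_norm ?invr_ge0//.
have -> : `| `|x|^-1| * `|f x| = `|f (`|x|^-1 *: x)| by rewrite linearZ /= normrZ.
apply: ub_le_sup; first by case: (dual_norm_has_sup f).
exists (`|x|^-1 *: x) => //.
by rewrite /unit_ball /= normrZ ger0_norm ?invr_ge0// mulVf// gt_eqF.
Qed.

Lemma dual_norm_leP (f : dual) (M : R) : 0 <= M ->
  (forall x, `|f x| <= M * `|x|) -> dual_norm f <= M.
Proof.
move=> M0 fM; apply: ge_sup; first by case: (dual_norm_has_sup f).
by move=> _ [x x1 <-]; rewrite (le_trans (fM x))// ler_piMr.
Qed.

Let dual_normD f g : dual_norm (f + g) <= dual_norm f + dual_norm g.
Proof.
apply: dual_norm_leP => [|x]; first by rewrite addr_ge0// dual_norm_ge0.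
by rewrite mulrDl (le_trans (ler_normD _ _))// lerD// dual_norm_le.
Qed.

Let dual_normZ_le a (f : dual) : dual_norm (a *: f) <= `|a| * dual_norm f.
Proof.
apply: dual_norm_leP => [|x]; first by rewrite mulr_ge0// dual_norm_ge0.
have -> : (a *: f : dual) x = a *: f x by [].
by rewrite normrZ -mulrA ler_wpM2l// dual_norm_le.
Qed.

Let dual_normZ a f : dual_norm (a *: f) = `|a| * dual_norm f.
Proof.
apply/eqP; rewrite eq_le dual_normZ_le/=.
have [->|a0] := eqVneq a 0; first by rewrite normr0 mul0r dual_norm_ge0.
rewrite -ler_pdivlMl ?normr_gt0// -normfV.
by rewrite (le_trans _ (dual_normZ_le _ _))// scalerA mulVf// scale1r.
Qed.

Let dual_norm0_eq0 (f : dual) : dual_norm f = 0 -> f = 0.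
Proof.
move=> f0; apply/val_inj/funext => x; apply/normr0_eq0/le_anti.
by rewrite normr_ge0 andbT (le_trans (dual_norm_le f x))// f0 mul0r.
Qed.

HB.instance Definition _ := Lmodule_isNormed.Build R dual
  dual_normD dual_normZ dual_norm0_eq0.

End Dual.

(* The supremum is taken in the extended reals, where sup set0 = -oo. *)
Definition norming_set (R : realType) (X : normedModType R)
    (A : set (dual X)) : Prop :=
  A `<=` unit_ball (dual X) /\
  forall x : X, `|x|%:E = ereal_sup [set (f x)%:E | f in A].

Definition norming_subspace (R : realType) (X : normedModType R)
    (F : closedSubspace (dual X)) : Prop :=
  norming_set ([set` F] `&` unit_ball (dual X)).

(* Completeness is not needed to state this notion. Closed subspaces and
   quotients by closed subspaces of a Banach space are complete, so the spaces
   subspace_type Y and quotient_type Y are Banach whenever X is. *)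
Definition nicely_smooth (R : realType) (X : normedModType R) : Prop :=
  ~ exists F : closedSubspace (dual X),
      norming_subspace F /\ [set` F] `<` [set: dual X].

(* Main.v *)
Require Import Defs.
From HB Require Import structures.
From mathcomp Require Import all_boot all_order all_algebra.
From mathcomp Require Import all_classical all_reals all_analysis lra.
Import Order.TTheory GRing.Theory Num.Theory.
Import numFieldNormedType.Exports.

Set Implicit Arguments.
Unset Strict Implicit.
Unset Printing Implicit Defensive.

Local Open Scope classical_set_scope.
Local Open Scope ring_scope.

(** The example is the space c of convergent real sequences with the sup norm,
    its subspace c_0 of null sequences, and the one-dimensional quotient c / c_0.

    The space c is not nicely smooth. The coordinate functionals alone recover
    the sup norm, and each of them vanishes on the indicator of [N, oo) for large
    N, whereas the limit functional takes the value 1 on each of these norm-one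
    indicators. So the functionals f with f(1_[N, oo)) --> 0 form a closed
    norming subspace that misses the limit ([tail_null_norming],
    [conv_not_nicely_smooth]).

    In c_0 the limit functional disappears. If f has norm at most 1 and
    f(e_i) > 1 - eps, then f is within 2 eps of the i-th coordinate functional,
    because the i-th entry of any member of the unit ball can be replaced by 1
    without leaving the ball. A norming subspace contains such f, since
    |e_i| = 1; being closed, it contains every coordinate functional
    ([norming_subspace_mem_peak]). Finite combinations of coordinate functionals
    are dense in the dual of c_0 ([dual_null_tail]), so a closed norming
    subspace is the whole dual.

    Finally, on a line a single functional that does not vanish spans the dual,
    and a norming subspace has one as soon as the line is nonzero
    ([nicely_smooth_dim1]). *)

(** * The Banach space of convergent sequences *)

Section ConvergentSequences.
Context (R : realType).

Definition conv_pred : {pred (nat -> R^o)} := fun u => `[< cvgn u >].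

Let conv_submod_closed : submod_closed conv_pred.
Proof.
split=> [|a u v /asboolP cu /asboolP cv]; apply/asboolP; first exact: is_cvg_cst.
by apply: is_cvgD => //; apply: is_cvgZr.
Qed.

HB.instance Definition _ := GRing.isSubmodClosed.Build R (nat -> R^o) conv_pred
  conv_submod_closed.

Definition conv_seq : Type := {u : nat -> R^o | u \in conv_pred}.

HB.instance Definition _ := SubChoice.on conv_seq.
HB.instance Definition _ := [SubChoice_isSubLmodule of conv_seq by <:].

Definition conv_fun (x : conv_seq) : nat -> R^o := val x.
Coercion conv_fun : conv_seq >-> Funclass.

Definition conv_of (u : nat -> R^o) (cu : cvgn u) : conv_seq :=
  Sub u (asboolT cu).

Lemma conv_cvg (x : conv_seq) : cvgn x.
Proof. by have /asboolP := valP x. Qed.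

Lemma conv_eq (x y : conv_seq) : (forall n, x n = y n) -> x = y.
Proof. by move=> xy; apply/val_inj/funext. Qed.

Lemma conv_funD (x y : conv_seq) n : (x + y : conv_seq) n = x n + y n.
Proof. by []. Qed.

Lemma conv_funZ a (x : conv_seq) n : (a *: x : conv_seq) n = a * x n.
Proof. by []. Qed.

Definition conv_norm (x : conv_seq) : R := sup (range (fun n => `|x n|)).

Lemma conv_norm_has_sup (x : conv_seq) : has_sup (range (fun n => `|x n|)).
Proof.
split; first by exists `|x 0%N|, 0%N.
have [M [_ xM]] := cvg_seq_bounded (@conv_cvg x).
by exists (M + 1) => _ [n _ <-]; apply: (xM (M + 1)) => //; rewrite ltrDl.
Qed.

Lemma conv_norm_ge (x : conv_seq) n : `|x n| <= conv_norm x.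
Proof. by apply: ub_le_sup; [case: (conv_norm_has_sup x)|exists n]. Qed.

Lemma conv_norm_le (x : conv_seq) (M : R) :
  (forall n, `|x n| <= M) -> conv_norm x <= M.
Proof.
move=> xM; apply: ge_sup; first by case: (conv_norm_has_sup x).
by move=> _ [n _ <-].
Qed.

Let conv_normD x y : conv_norm (x + y) <= conv_norm x + conv_norm y.
Proof.
apply: conv_norm_le => n; rewrite conv_funD (le_trans (ler_normD _ _))//.
by rewrite lerD// conv_norm_ge.
Qed.

Let conv_normZ a x : conv_norm (a *: x) = `|a| * conv_norm x.
Proof.
have norm_le b y : conv_norm (b *: y) <= `|b| * conv_norm y.
  by apply: conv_norm_le => n; rewrite conv_funZ normrM ler_wpM2l// conv_norm_ge.
apply/eqP; rewrite eq_le norm_le/=.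
have [->|a0] := eqVneq a 0.
  by rewrite normr0 mul0r (le_trans (normr_ge0 _) (conv_norm_ge _ 0%N)).
rewrite -ler_pdivlMl ?normr_gt0// -normfV.
by rewrite (le_trans _ (norm_le _ _))// scalerA mulVf// scale1r.
Qed.

Let conv_norm0_eq0 x : conv_norm x = 0 -> x = 0.
Proof.
move=> x0; apply: conv_eq => n; apply/normr0_eq0/le_anti.
by rewrite normr_ge0 andbT -x0 conv_norm_ge.
Qed.

HB.instance Definition _ := Lmodule_isNormed.Build R conv_seq
  conv_normD conv_normZ conv_norm0_eq0.

Lemma conv_coord_le (x : conv_seq) n : `|x n| <= `|x|.
Proof. exact: conv_norm_ge. Qed.

Lemma conv_le_norm (x : conv_seq) (M : R) :
  (forall n, `|x n| <= M) -> `|x| <= M.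
Proof. exact: conv_norm_le. Qed.

(** The coordinates of a Cauchy filter converge, and the sup norm makes the
    convergence uniform in the index; a uniform limit of convergent sequences is
    a Cauchy sequence, hence again in the space. *)
Lemma conv_cauchy_cvg (F : set_system conv_seq) :
  ProperFilter F -> cauchy F -> cvg F.
Proof.
move=> FF /cauchyP Fc.
have Fe e : 0 < e -> exists x : conv_seq, \forall y \near F, `|x - y| < e.
  by move=> /Fc[x xe]; exists x; apply: filterS xe => y; rewrite -ball_normE.
have cF n : cvg ((fun x : conv_seq => x n : R^o) @ F).
  apply/cauchy_cvgP/cauchyP => e e0.
  have [x xe] := Fe _ e0; exists (x n); apply: filterS xe => y.
  rewrite -ball_normE /=; apply: le_lt_trans.
  exact: (conv_coord_le (x - y)).
pose u n : R^o := lim ((fun x : conv_seq => x n : R^o) @ F).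
have near_u e (x : conv_seq) : (\forall y \near F, `|x - y| < e) ->
    forall n, `|x n - u n| <= e.
  move=> xe n; apply: (closed_cvg (fun t : R^o => `|x n - t| <= e) _ _ _ (cF n)).
    apply: (@closed_comp _ _ (fun t : R^o => `|x n - t|) [set s | s <= e]).
      move=> t _; apply: cvg_norm; apply: cvgB; [exact: cvg_cst|exact: cvg_id].
    exact: closed_le.
  apply: filterS xe => y /ltW; apply: le_trans.
  exact: (conv_coord_le (x - y)).
have cu : cvgn u.
  apply/cauchy_cvgP/cauchyP => e e0.
  have e20 : 0 < e / 2 by rewrite divr_gt0.
  have [x xe] := Fe _ e20.
  have xu := near_u _ _ xe.
  exists (limn x).
  have /cvgrPdist_lt/(_ _ e20) := @conv_cvg x.
  apply: filterS => n xn; rewrite -ball_normE /=.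
  rewrite (_ : _ - _ = (limn x - x n) + (x n - u n)); last by rewrite addrA subrK.
  by rewrite (le_lt_trans (ler_normD _ _))// [ltRHS]splitr ltr_leD.
apply: (cvgP (conv_of cu)); apply/fcvgrPdist_lt => e e0.
have e20 : 0 < e / 2 by rewrite divr_gt0.
have [x xe] := Fe _ e20.
apply: filterS (xe) => y xy; rewrite -(subrKA x) [ltRHS]splitr.
apply: le_lt_trans (ler_normD _ _) _; rewrite ler_ltD//.
rewrite distrC; apply: conv_le_norm => n; exact: near_u.
Qed.

HB.instance Definition _ := Uniform_isComplete.Build conv_seq conv_cauchy_cvg.

End ConvergentSequences.

(** * Functionals and norming subspaces *)

Section Norming.
Context (R : realType) (X : normedModType R).

Lemma contraction_dual_pred (f : X -> R^o) :
  linear f -> (forall x, `|f x| <= `|x|) -> f \in @dual_pred R X.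
Proof.
move=> lf bf; apply/asboolP; split=> // x; apply/cvgrPdist_le => e e0.
have /cvgrPdist_le/(_ e e0) := @cvg_id _ (nbhs x); apply: filterS => y.
have -> : f x - f y = f (x - y).
  by rewrite [in RHS]addrC -[- y]scaleN1r lf scaleN1r addrC.
exact: le_trans (bf _).
Qed.

Definition contraction_dual (f : X -> R^o) (lf : linear f)
  (bf : forall x, `|f x| <= `|x|) : dual X := Sub f (contraction_dual_pred lf bf).

Lemma mem_adherent (F : closedSubspace X) (x : X) :
  (forall e, 0 < e -> exists2 y, y \in F & `|x - y| <= e) -> x \in F.
Proof.
move=> xF; apply: (closed_predP (c := F)) => B /nbhs_ballP[e /= e0 eB].
have e20 : 0 < e / 2 by rewrite divr_gt0.
have [y Fy xy] := xF _ e20; exists y; split => //; apply: eB.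
by rewrite -ball_normE /= (le_lt_trans xy)// ltr_pdivrMr// ltr_pMr// ltr1n.
Qed.

End Norming.

Section NormingDual.
Context (R : realType) (X : normedModType R).

Lemma dual_normP (f : dual X) x : `|f x| <= `|f| * `|x|.
Proof. exact: dual_norm_le. Qed.

Lemma dualD (f : dual X) x y : f (x + y) = f x + f y.
Proof. by rewrite linearD. Qed.

Lemma dualB (f : dual X) x y : f (x - y) = f x - f y.
Proof. by rewrite linearB. Qed.

Lemma dualZ (f : dual X) a x : f (a *: x) = a * f x.
Proof. by rewrite linearZ. Qed.

Definition dual_kernel_pred (f : dual X) : {pred X} := fun x => f x == 0.

Lemma dual_kernel_submod_closed (f : dual X) : submod_closed (dual_kernel_pred f).
Proof.
split=> [|a x y /eqP fx /eqP fy]; apply/eqP; first exact: linear0.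
by rewrite dualD dualZ fx fy mulr0 addr0.
Qed.

Lemma dual_kernel_closed (f : dual X) : closed [set` dual_kernel_pred f].
Proof.
rewrite (_ : [set` _] = f @^-1` [set 0]).
  apply: closed_comp => [x _|]; first exact: dual_continuous.
  exact: closed_eq.
by apply/seteqP; split=> x /eqP.
Qed.

Definition dual_kernel (f : dual X) : closedSubspace X :=
  ClosedSubspace (dual_kernel_submod_closed f) (@dual_kernel_closed f).

Lemma dual_funZ a (f : dual X) x : (a *: f : dual X) x = a * f x.
Proof. by []. Qed.

Lemma dual_funB (f g : dual X) x : (f - g : dual X) x = f x - g x.
Proof. by []. Qed.

Lemma dual_norm_le_ball (f : dual X) (M : R) :
  (forall x, `|x| <= 1 -> `|f x| <= M) -> `|f| <= M.
Proof.
move=> fM; apply: ge_sup; first by case: (dual_norm_has_sup f).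
by move=> _ [x x1 <-]; exact: fM.
Qed.

Lemma contraction_norm_le1 (f : dual X) :
  (forall x, `|f x| <= `|x|) -> `|f| <= 1.
Proof. by move=> fx; apply: dual_norm_le_ball => x; exact: le_trans. Qed.

(** Almost norming functionals replace the extended real supremum in the later
    arguments; [norming_subspaceP] is the converse. *)
Lemma norming_subspace_lt (F : closedSubspace (dual X)) (x : X) (e : R) :
  norming_subspace F -> 0 < e ->
  exists f : dual X, [/\ f \in F, `|f| <= 1 & `|x| - e < f x].
Proof.
move=> [_ /(_ x) Fx] e0.
have : ((`|x| - e)%:E < `|x|%:E)%E by rewrite lte_fin gtrBl.
rewrite Fx => /ereal_sup_gt[_ [f [Ff f1] <-]]; rewrite lte_fin => fx.
by exists f.
Qed.

Lemma norming_subspaceP (F : closedSubspace (dual X)) :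
  (forall (x : X) e, 0 < e ->
     exists f : dual X, [/\ f \in F, `|f| <= 1 & `|x| - e < f x]) ->
  norming_subspace F.
Proof.
move=> FX; split=> [f []//|x]; apply/eqP; rewrite eq_le; apply/andP; split.
  apply/lee_addgt0Pr => e e0; have [f [Ff f1 /ltW]] := FX x e e0.
  rewrite lerBlDr => fx; rewrite (@le_trans _ _ (f x + e)%:E)//.
  by rewrite EFinD leeD2r// ereal_sup_ubound//; exists f.
apply: ge_ereal_sup => _ [f [_ f1] <-]; rewrite lee_fin.
by rewrite (le_trans (ler_norm _))// (le_trans (dual_normP f x))// ler_piMl.
Qed.

Lemma nicely_smoothP :
  (forall F : closedSubspace (dual X), norming_subspace F ->
     forall f : dual X, f \in F) ->
  nicely_smooth X.
Proof. by move=> XF [F [/XF FX []]] _; apply => f _; exact: FX. Qed.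

(** The point p may be 0, in which case the space and its dual are trivial. *)
Lemma nicely_smooth_dim1 (p : X) :
  (forall x, exists a : R, x = a *: p) -> nicely_smooth X.
Proof.
move=> span_p; apply: nicely_smoothP => F nF g.
have [p0|p_neq0] := eqVneq p 0.
  suff -> : g = 0 by exact: rpred0.
  by apply/val_inj/funext => x; have [a ->] := span_p x; rewrite p0 scaler0 [LHS](linear0 g).
have p_gt0 : 0 < `|p| by rewrite normr_gt0.
have [f [Ff _]] := norming_subspace_lt p nF p_gt0; rewrite subrr => fp.
suff -> : g = (g p / f p) *: f by exact: rpredZ.
apply/val_inj/funext => x; have [a ->] := span_p x.
rewrite [LHS](dualZ g) [RHS](dual_funZ (g p / f p) f) dualZ.
by rewrite mulrCA divfK// gt_eqF.
Qed.

(** Take f in F of norm at most 1 with f p > 1 - e / 2. The last hypothesis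
    bounds f (x + (1 - phi x) *: p) by 1 for x in the unit ball; applied to x
    and to - x, it gives |f x - phi x * f p| <= e / 2, so f is e-close to phi.
    In c_0, phi is a coordinate and p the corresponding unit vector. *)
Lemma norming_subspace_mem_peak (F : closedSubspace (dual X)) (phi : dual X)
    (p : X) :
  norming_subspace F -> (forall x, `|phi x| <= `|x|) -> `|p| = 1 ->
  (forall x, `|x| <= 1 -> `|x + (1 - phi x) *: p| <= 1) ->
  phi \in F.
Proof.
move=> nF phi1 p1 peak; apply: mem_adherent => e e0.
have e20 : 0 < e / 2 by rewrite divr_gt0.
have [f [Ff f1]] := norming_subspace_lt p nF e20; rewrite p1 => fp.
exists f => //; apply: dual_norm_le_ball => x x1.
have fball z : `|z| <= 1 -> f z <= 1.
  move=> z1; rewrite (le_trans (ler_norm _))// (le_trans (dual_normP f z))//.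
  by rewrite mulr_ile1.
have fphi z : `|z| <= 1 -> f z - phi z * f p <= e / 2.
  move=> /peak/fball; rewrite dualD dualZ => ?; lra.
have fx : `|f x - phi x * f p| <= e / 2.
  rewrite ler_norml fphi// andbT lerNl.
  have := fphi (- x); rewrite normrN !linearN /= mulNr => /(_ x1) fNx; lra.
have -> : (phi - f : dual X) x = phi x * (1 - f p) - (f x - phi x * f p).
  by rewrite dual_funB mulrBr mulr1 opprB addrA subrK.
rewrite (le_trans (ler_normB _ _))// [leRHS]splitr lerD// normrM.
have fp1 : f p <= 1 by apply: fball; rewrite p1.
rewrite (@le_trans _ _ `|1 - f p|)//.
  by rewrite ler_piMl// (le_trans (phi1 x)).
by rewrite ger0_norm ?subr_ge0// lerBlDr -lerBlDl ltW.
Qed.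

End NormingDual.

(** The quotient is the line through the class of p, as x - f x *: p lies in
    the kernel. *)
Lemma nicely_smooth_quotient_kernel (R : realType) (X : normedModType R)
    (f : dual X) (p : X) :
  f p = 1 -> nicely_smooth (quotient_type (dual_kernel f)).
Proof.
move=> fp; apply: (@nicely_smooth_dim1 _ _ (quotient_proj (dual_kernel f) p)) => q.
exists (f (repr q)); rewrite [RHS](_ : _ = quotient_proj _ (f (repr q) *: p)).
  rewrite -[LHS]quotient_proj_repr; apply/quotient_projP.
  by apply/eqP; rewrite dualB dualZ fp mulr1 subrr.
by rewrite quotient_projZ.
Qed.

(** * The space of convergent sequences is not nicely smooth *)

Section Limit.
Context (R : realType).
Implicit Types x y : conv_seq R.

Lemma eventually_cst_cvg (u : nat -> R^o) N (c : R^o) :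
  (forall n, (N <= n)%N -> u n = c) -> u @ \oo --> c.
Proof.
move=> uc; apply: cvg_near_cst.
by exists N => // n /= Nn; apply/eqP; rewrite uc.
Qed.

Lemma limn_linear : linear (fun x => limn x : R^o).
Proof.
move=> a x y; apply/cvg_lim => //.
by apply: cvgD; [apply: cvgZr; exact: conv_cvg|exact: conv_cvg].
Qed.

Lemma limn_contraction x : `|limn x : R^o| <= `|x|.
Proof.
have /cvg_norm/cvg_lim <- // := @conv_cvg _ x.
apply: limr_le; first by apply: is_cvg_norm; exact: conv_cvg.
by apply: nearW => n; exact: conv_coord_le.
Qed.

Definition lim_dual : dual (conv_seq R) :=
  contraction_dual limn_linear limn_contraction.

Lemma coord_linear n : linear (fun x => x n : R^o).
Proof. by []. Qed.

Definition coord n : dual (conv_seq R) :=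
  contraction_dual (coord_linear n) (fun x => conv_coord_le x n).

Lemma tail_one_cvg N : cvgn (fun n => (N <= n)%:R : R^o).
Proof. by apply: cvgP (@eventually_cst_cvg _ N 1 _) => n ->. Qed.

Definition tail_one N : conv_seq R := conv_of (@tail_one_cvg N).

Lemma tail_oneE N n : tail_one N n = (N <= n)%:R.
Proof. by []. Qed.

Lemma tail_one_norm N : `|tail_one N| <= 1.
Proof. by apply: conv_le_norm => n; rewrite tail_oneE normr_nat; case: leq. Qed.

Lemma lim_dual_tail_one N : lim_dual (tail_one N) = 1.
Proof. by apply/cvg_lim => //; apply: (@eventually_cst_cvg _ N) => n Nn; rewrite tail_oneE Nn. Qed.

(** In terms of the usual identification of the dual of c with l_1, where the
    extra coordinate is the mass at infinity, f (tail_one N) tends to that mass,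
    so these are the functionals for which it vanishes. The present form needs no representation of the dual. *)
Definition tail_null_pred : {pred dual (conv_seq R)} :=
  fun f => `[< (fun N => f (tail_one N)) @ \oo --> (0 : R^o) >].

Lemma tail_null_submod_closed : submod_closed tail_null_pred.
Proof.
split=> [|a f g /asboolP f0 /asboolP g0]; apply/asboolP; first exact: cvg_cst.
rewrite (_ : 0 = a *: 0 + 0 :> R^o); last by rewrite scaler0 addr0.
by apply: cvgD => //; apply: cvgZr.
Qed.

Lemma tail_null_adherent (f : dual (conv_seq R)) :
  closure [set` tail_null_pred] f -> f \in tail_null_pred.
Proof.
move=> fF; apply/asboolP/cvgrPdist_le => e e0.
have e20 : 0 < e / 2 by rewrite divr_gt0.
have [g [gF fg]] : exists g : dual (conv_seq R), g \in tail_null_pred /\ `|f - g| < e / 2.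
  have [g [gF]] := fF _ (nbhsx_ballx f _ e20).
  by rewrite -ball_normE => fg; exists g.
move: gF => /asboolP/cvgrPdist_le/(_ _ e20); apply: filterS => N.
rewrite !sub0r !normrN => gN.
rewrite -(subrK (g (tail_one N)) (f _)) -dual_funB.
rewrite (le_trans (ler_normD _ _))// [leRHS]splitr lerD//.
rewrite (le_trans (dual_normP _ _))// (le_trans _ (ltW fg))//.
by rewrite ler_piMr// tail_one_norm.
Qed.

Lemma tail_null_closed : closed [set` tail_null_pred].
Proof. exact: tail_null_adherent. Qed.

Definition tail_null : closedSubspace (dual (conv_seq R)) :=
  ClosedSubspace tail_null_submod_closed tail_null_closed.

Lemma coord_tail_null n : coord n \in tail_null.
Proof.
apply/asboolP; apply: (@eventually_cst_cvg _ n.+1) => N nN.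
by rewrite [LHS](_ : _ = tail_one N n)// tail_oneE leqNgt nN.
Qed.

Lemma coord_norm_le1 n : `|coord n| <= 1.
Proof. by apply: contraction_norm_le1 => x; exact: conv_coord_le. Qed.

Lemma coord_norm_lt x e : 0 < e -> exists n, `|x| - e < `|coord n x|.
Proof.
by move=> e0; have [_ [n _ <-] xn] := sup_adherent e0 (conv_norm_has_sup x); exists n.
Qed.

Lemma tail_null_norming : norming_subspace tail_null.
Proof.
apply: norming_subspaceP => x e e0.
have [n xn] := coord_norm_lt x e0.
exists ((-1) ^+ (coord n x < 0)%R *: coord n); split.
- by rewrite rpredZ// coord_tail_null.
- by rewrite normrZ normr_sign mul1r coord_norm_le1.
by rewrite dual_funZ -normrEsign.
Qed.

Lemma conv_not_nicely_smooth : ~ nicely_smooth (conv_seq R).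
Proof.
apply; exists tail_null; split; first exact: tail_null_norming.
split=> // /(_ lim_dual I) /asboolP lim0.
have : (fun N => lim_dual (tail_one N)) @ \oo --> (1 : R^o).
  by apply: (@eventually_cst_cvg _ 0%N) => N _; exact: lim_dual_tail_one.
move=> /cvg_lim lim1; have := lim1 (@Rhausdorff R).
by rewrite (cvg_lim (@Rhausdorff R) lim0) => /esym/eqP; rewrite oner_eq0.
Qed.

End Limit.

(** * The space of null sequences is nicely smooth *)

Section NullSequences.
Context (R : realType).

Definition null_seq := subspace_type (dual_kernel (lim_dual R)).
Implicit Types y : null_seq.

Lemma null_coord_linear n : linear (fun y => (val y : conv_seq R) n : R^o).
Proof. by move=> a y z; rewrite linearP. Qed.

Definition null_coord n : dual null_seq :=
  contraction_dual (null_coord_linear n) (fun y => conv_coord_le (val y) n).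

Lemma null_coord_le y n : `|null_coord n y| <= `|y|.
Proof. exact: conv_coord_le. Qed.

Lemma null_le_norm y (M : R) : (forall n, `|null_coord n y| <= M) -> `|y| <= M.
Proof. exact: conv_le_norm. Qed.

Lemma null_cvg0 y : (fun n => null_coord n y : R^o) @ \oo --> (0 : R^o).
Proof. by have /eqP <- := valP y; exact: conv_cvg. Qed.

Lemma delta_cvg0 i : (fun n => (n == i)%:R : R^o) @ \oo --> (0 : R^o).
Proof.
by apply: (@eventually_cst_cvg _ _ i.+1) => n ni; rewrite gtn_eqF.
Qed.

Definition delta_conv i : conv_seq R := conv_of (cvgP _ (@delta_cvg0 i)).

Lemma delta_kernel i : delta_conv i \in dual_kernel (lim_dual R).
Proof. by apply/eqP/cvg_lim => //; exact: delta_cvg0. Qed.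

Definition delta i : null_seq := Sub (delta_conv i) (delta_kernel i).

Lemma null_coord_delta n i : null_coord n (delta i) = (n == i)%:R.
Proof. by []. Qed.

Lemma delta_norm i : `|delta i| = 1.
Proof.
apply/eqP; rewrite eq_le; apply/andP; split.
  by apply: null_le_norm => n; rewrite null_coord_delta normr_nat; case: eqP.
by have := null_coord_le (delta i) i; rewrite null_coord_delta eqxx normr1.
Qed.

Lemma null_coord_mem (F : closedSubspace (dual null_seq)) i :
  norming_subspace F -> null_coord i \in F.
Proof.
move=> nF; apply: (norming_subspace_mem_peak nF _ (delta_norm i)) => [y|y y1].
  exact: null_coord_le.
apply: null_le_norm => n.
rewrite dualD dualZ null_coord_delta.
have [->|_] := eqVneq n i; first by rewrite mulr1 addrC subrK normr1.
by rewrite mulr0 addr0 (le_trans (null_coord_le y n)).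
Qed.

Lemma null_coord_rest N y n :
  null_coord n (y - \sum_(i < N) null_coord i y *: delta i) =
  if (n < N)%N then 0 else null_coord n y.
Proof.
elim: N => [|N IH]; first by rewrite big_ord0 subr0.
rewrite big_ord_recr opprD addrA dualB IH dualZ null_coord_delta /= ltnS.
case: ltngtP => [_|_|->]; rewrite ?mulr0 ?subr0// mulr1 subrr//.
Qed.

(** Functionals on c_0 have no mass at infinity: if y in the unit ball nearly
    attains the norm of f and is small from N on, then y + w and y - w stay in
    a slightly larger ball for every w in the unit ball supported on [N, oo), so
    that f w cannot add much to f y. This makes the finite sums
    \sum_(i < N) f (delta i) *: null_coord i approximate f in norm. *)
Lemma dual_null_tail (f : dual null_seq) (e : R) : 0 < e ->
  exists N, forall w, (forall n, (n < N)%N -> null_coord n w = 0) ->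
    `|w| <= 1 -> `|f w| <= e.
Proof.
(* With slack d the argument yields |f w| <= |f| * (1 + d) - (|f| - d), which
   is d * (|f| + 1). *)
move=> e0; pose d := e / (`|f| + 1).
have f1 : 0 < `|f| + 1 by rewrite ltr_wpDl.
have d0 : 0 < d by rewrite divr_gt0.
have [_ [y y1 <-] fy] := sup_adherent d0 (dual_norm_has_sup f).
have /cvgrPdist_le/(_ _ d0)[N _ yN] := @null_cvg0 y.
exists N => w w0 w1.
have fball z : `|z| <= 1 + d -> `|f z| <= `|f| * (1 + d).
  by move=> zd; rewrite (le_trans (dual_normP f z))// ler_wpM2l.
have yw (s : R) : `|s| = 1 -> `|y + s *: w| <= 1 + d.
  move=> s1; apply: null_le_norm => n.
  rewrite dualD dualZ.
  have [nN|Nn] := ltnP n N.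
    rewrite w0// mulr0 addr0 (le_trans (null_coord_le y n))//.
    by rewrite (le_trans y1)// lerDl ltW.
  rewrite addrC (le_trans (ler_normD _ _))// lerD//.
    by rewrite normrM s1 mul1r (le_trans (null_coord_le w n)).
  by have := yN n Nn; rewrite /= sub0r normrN.
have fyw (s : R) : `|s| = 1 -> `|f y + s * f w| <= `|f| * (1 + d).
  by move=> /yw/fball; rewrite dualD dualZ.
have : `|f y| + `|f w| <= `|f| * (1 + d).
  have := fyw 1 (normr1 _); have := fyw (-1) (normrN1 _).
  rewrite !ler_norml; case: (ler0P (f y)) => _; case: (ler0P (f w)) => _; lra.
have {}fy : `|f| - d < `|f y| by [].
have -> : e = d * (`|f| + 1) by rewrite divfK// gt_eqF.
lra.
Qed.

Lemma null_nicely_smooth : nicely_smooth null_seq.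
Proof.
apply: nicely_smoothP => F nF f; apply: mem_adherent => e e0.
have [N fN] := dual_null_tail f e0.
exists (\sum_(i < N) f (delta i) *: null_coord i).
  by apply: rpred_sum => i _; rewrite rpredZ// null_coord_mem.
apply: dual_norm_le_ball => y y1.
have -> : (f - \sum_(i < N) f (delta i) *: null_coord i : dual null_seq) y =
    f (y - \sum_(i < N) null_coord i y *: delta i).
  rewrite dual_funB dualB; congr (_ - _).
  elim: N {fN} => [|N IH]; first by rewrite !big_ord0 linear0.
  rewrite !big_ord_recr dualD -IH dualZ mulrC.
  by [].
apply: fN => [n nN|]; first by rewrite null_coord_rest nN.
apply: null_le_norm => n; rewrite null_coord_rest.
by case: ifP; rewrite ?normr0// (le_trans (null_coord_le y n)).
Qed.

End NullSequences.

Theorem corollary12 (R : realType) :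
  exists (X : completeNormedModType R) (Y : closedSubspace X),
    nicely_smooth (subspace_type Y) /\
    nicely_smooth (quotient_type Y) /\
    ~ nicely_smooth X.
Proof.
exists (conv_seq R), (dual_kernel (lim_dual R)); split; last split.
- exact: null_nicely_smooth.
- exact: nicely_smooth_quotient_kernel (lim_dual_tail_one R 0).
- exact: conv_not_nicely_smooth.
Qed.
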